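(* Let $G$ be a signed graph on the vertex set $[n+1]$ and let $\mathbf{a}=(2,0,\ldots,0)\in\mathbb{Z}^{n+1}$. Then the vertices of the flow polytope $\mathcal{F}_G(\mathbf{a})$ are integer. In particular, the set of vertices of $\mathcal{F}_G(\mathbf{a})$ is a subset of the set of integer $\mathbf{a}$-flows on $G$.
   Context: A signed graph $G$ on $[n+1]=\{1,\ldots,n+1\}$ is a finite graph, loops and multiple edges allowed, each edge carrying a sign. An edge between $i<j$ is written $(i,j,-)$ or $(i,j,+)$; loops always have sign $+$ and are written $(i,i,+)$. To each edge associate a vector: $(i,j,-)\mapsto\mathbf{e}_i-\mathbf{e}_j$, $(i,j,+)\mapsto\mathbf{e}_i+\mathbf{e}_j$ (so $(i,i,+)\mapsto 2\mathbf{e}_i$), where $\mathbf{e}_i$ is the $i$-th standard basis vector of $\mathbb{R}^{n+1}$. Let $M_G$ be the matrix whose columns are these vectors. An $\mathbf{a}$-flow on $G$ is a vector $f\in\mathbb{R}_{\ge0}^{E(G)}$ with $M_Gf=\mathbf{a}$; it is an integer $\mathbf{a}$-flow if all its entries are integers. $\mathcal{F}_G(\mathbf{a})$ is the set of all $\mathbf{a}$-flows on $G$. *)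

(* Defs.v *)
From HB Require Import structures.
From mathcomp Require Import all_boot all_order all_algebra.
From mathcomp Require Import classical_sets reals.

Set Implicit Arguments.
Unset Strict Implicit.
Unset Printing Implicit Defensive.

Import Order.TTheory GRing.Theory Num.Theory.
Local Open Scope ring_scope.
Local Open Scope classical_set_scope.

(* The vertex set {1, ..., n+1} is 'I_n.+1, with ord0 for the vertex 1. *)
Record signed_edge (n : nat) := SignedEdge {
  src : 'I_n.+1;
  tgt : 'I_n.+1;
  positive : bool;
  src_le_tgt : (src <= tgt)%N;
  loop_positive : src = tgt -> positive
}.

(* Edges are indexed by 'I_m, so parallel edges with the same sign are
   distinct edges. *)
Record signed_graph (n : nat) := SignedGraph {
  num_edges : nat;
  edge : 'I_num_edges -> signed_edge n
}.

(* A positive loop at i gives e_i + e_i = 2 e_i. *)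
Definition edge_vector (R : realType) (n : nat) (e : signed_edge n) :
    'cV[R]_n.+1 :=
  if positive e then delta_mx (src e) 0 + delta_mx (tgt e) 0
  else delta_mx (src e) 0 - delta_mx (tgt e) 0.

Definition incidence_matrix (R : realType) (n : nat) (G : signed_graph n) :
    'M[R]_(n.+1, num_edges G) :=
  \matrix_(i, k) edge_vector R (edge k) i 0.

Definition flow_polytope (R : realType) (n : nat) (G : signed_graph n)
    (a : 'cV[R]_n.+1) : set 'cV[R]_(num_edges G) :=
  [set f : 'cV[R]_(num_edges G) |
    (forall k, 0 <= f k 0) /\ incidence_matrix R G *m f = a].
Arguments flow_polytope {R n} G a _.

Definition integral_vector (R : realType) (m : nat) (f : 'cV[R]_m) : Prop :=
  forall k, f k 0 \is a Num.int.

Definition integer_flows (R : realType) (n : nat) (G : signed_graph n)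
    (a : 'cV[R]_n.+1) : set 'cV[R]_(num_edges G) :=
  [set f : 'cV[R]_(num_edges G) | flow_polytope G a f /\ integral_vector f].
Arguments integer_flows {R n} G a _.

(* Extreme points; for a polyhedron these are the zero-dimensional faces. *)
Definition vertices (R : realType) (m : nat) (P : set 'cV[R]_m) :
    set 'cV[R]_m :=
  [set v : 'cV[R]_m | P v /\
    forall (x y : 'cV[R]_m) (t : R), P x -> P y -> 0 < t < 1 ->
      v = t *: x + (1 - t) *: y -> x = v /\ y = v].

(* Main.v *)
Require Import Defs.
From mathcomp Require Import all_boot all_order all_algebra.
From mathcomp Require Import classical_sets reals.

Set Implicit Arguments.
Unset Strict Implicit.
Unset Printing Implicit Defensive.

Import Order.TTheory GRing.Theory Num.Theory.
Local Open Scope ring_scope.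
Local Open Scope classical_set_scope.

(** Write [a = 2 e_1].  Every [a]-flow [f] dominates a small positive multiple
    of some integer [a]-flow [g] whose support lies in that of [f]
    ([integer_flow_in_support]).  Then [f] is a proper convex combination of [g]
    and the rescaled difference [(f - t g) / (1 - t)], again an [a]-flow, so a
    vertex [f] must be equal to [g] ([vertex_unique_in_support]).

    The flow [g] has an explicit shape.  Only edges [(i,j,+)] have a nonzero
    coordinate sum, and the coordinates of [a] sum to 2, so [f] uses some
    positive edge [(i,j,+)] ([positive_edge_in_support]).  Conservation at the
    vertices other than 1 allows one to walk back, along negative edges used by
    [f], from [i] and from [j] to vertex 1 ([negative_path_in_support]): such
    edges go from a smaller vertex to a larger one, so the walk ends.  The two
    paths contribute [e_1 - e_i] and [e_1 - e_j], and with the edge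
    [(i,j,+)] they sum to [2 e_1]. *)

Lemma incidence_matrix_delta (R : realType) n (G : signed_graph n) k :
  incidence_matrix R G *m delta_mx k 0 = edge_vector R (edge k).
Proof.
by rewrite -colE; apply/colP => i; rewrite !mxE.
Qed.

Lemma edge_vectorE (R : realType) n (e : signed_edge n) i :
  edge_vector R e i 0 =
    (i == src e)%:R + (if positive e then 1 else -1) * (i == tgt e)%:R.
Proof.
by rewrite /edge_vector; case: ifP => _; rewrite !mxE !andbT ?mul1r ?mulN1r.
Qed.

Lemma negative_edge_src_lt_tgt n (e : signed_edge n) :
  ~~ positive e -> (src e < tgt e)%N.
Proof.
move=> neg_e; rewrite ltn_neqAle src_le_tgt andbT.
by apply: contra neg_e => /eqP/val_inj/loop_positive.
Qed.

Lemma edge_vector_src_gt0 (R : realType) n (e : signed_edge n) :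
  0 < edge_vector R e (src e) 0.
Proof.
rewrite edge_vectorE eqxx; case: ifPn => [_|/negative_edge_src_lt_tgt].
  by rewrite mul1r ltr_pwDl.
by rewrite ltn_neqAle => /andP[/negPf ne _]; rewrite -val_eqE /= ne mulr0 addr0.
Qed.

Lemma edge_vector_tgt_gt0 (R : realType) n (e : signed_edge n) :
  positive e -> 0 < edge_vector R e (tgt e) 0.
Proof. by rewrite edge_vectorE eqxx => ->; rewrite mulr1 ltr_wpDl. Qed.

Lemma edge_vector_lt0 (R : realType) n (e : signed_edge n) i :
  edge_vector R e i 0 < 0 -> ~~ positive e /\ tgt e = i.
Proof.
rewrite edge_vectorE; case: ifP => _.
  by rewrite mul1r ltNge addr_ge0.
case: (eqVneq i (tgt e)) => [-> //|_].
by rewrite mulr0 addr0 ltNge ler0n.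
Qed.

Lemma sum_negative_edge_vector (R : realType) n (e : signed_edge n) :
  ~~ positive e -> \sum_i edge_vector R e i 0 = 0.
Proof.
move=> /negPf neg_e.
under eq_bigr => i _ do rewrite edge_vectorE neg_e mulN1r.
have sum1 j : \sum_(i < n.+1) (i == j)%:R = 1 :> R.
  by rewrite (bigD1 j) //= eqxx big1 ?addr0 // => i /negPf->.
by rewrite big_split /= sumrN !sum1 subrr.
Qed.

Definition nat_supported_in (R : realType) m (f g : 'cV[R]_m) : Prop :=
  forall k, g k 0 \is a Num.nat /\ (f k 0 = 0 -> g k 0 = 0).

Lemma nat_supported_in0 (R : realType) m (f : 'cV[R]_m) :
  nat_supported_in f 0.
Proof. by move=> k; rewrite mxE rpred0. Qed.

Lemma nat_supported_inD (R : realType) m (f g h : 'cV[R]_m) :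
  nat_supported_in f g -> nat_supported_in f h -> nat_supported_in f (g + h).
Proof.
move=> fg fh k; have [gN g0] := fg k; have [hN h0] := fh k.
by rewrite mxE rpredD //; split=> // f0; rewrite g0 // h0 // addr0.
Qed.

Lemma nat_supported_in_delta (R : realType) m (f : 'cV[R]_m) k :
  0 < f k 0 -> nat_supported_in f (delta_mx k 0).
Proof.
move=> fk_gt0 l; rewrite mxE andbT natr_nat; split=> // fl0.
by case: eqVneq => // lk; move: fk_gt0; rewrite -lk fl0 ltxx.
Qed.

(** Flow that enters a conserving vertex must leave it: a vanishing sum with a
    positive term also has a negative one. *)
Lemma conservation_negative_term (R : realType) n (G : signed_graph n)
    (f : 'cV[R]_(num_edges G)) i k :
  (forall l, 0 <= f l 0) -> (incidence_matrix R G *m f) i 0 = 0 ->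
  0 < f k 0 -> 0 < edge_vector R (edge k) i 0 ->
  exists l, 0 < f l 0 /\ edge_vector R (edge l) i 0 < 0.
Proof.
move=> f_ge0 Mf0 fk_gt0 ek_gt0.
have [/existsP[l /andP[fl el]]|/existsPn noneg] :=
  boolP [exists l, (0 < f l 0) && (edge_vector R (edge l) i 0 < 0)].
  by exists l.
suff : 0 < (incidence_matrix R G *m f) i 0 by rewrite Mf0 ltxx.
rewrite mxE (bigD1 k) //= ltr_pwDl // ?mxE ?mulr_gt0 //.
apply: sumr_ge0 => l _; rewrite mxE.
have := noneg l; have := f_ge0 l; rewrite le_eqVlt => /predU1P[<-|fl_gt0].
  by rewrite mulr0.
by rewrite fl_gt0 -leNgt => el; rewrite mulr_ge0 // ltW.
Qed.

(** The walk back to vertex 1: a vertex [i] other than 1 where [f] has a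
    positive contribution also has a negative one, necessarily from an edge
    [(j,i,-)] with [j < i]; that edge contributes positively at [j], so
    induction on the vertex applies. *)
Lemma negative_path_in_support (R : realType) n (G : signed_graph n)
    (f : 'cV[R]_(num_edges G)) :
  (forall l, 0 <= f l 0) ->
  (forall i, i != ord0 -> (incidence_matrix R G *m f) i 0 = 0) ->
  forall i k, 0 < f k 0 -> 0 < edge_vector R (edge k) i 0 ->
  exists g, nat_supported_in f g /\
    incidence_matrix R G *m g = delta_mx ord0 0 - delta_mx i 0.
Proof.
move=> f_ge0 Mf0 i; have [m le_im] := ubnP (i : nat).
elim: m => // m IHm in i le_im * => k fk_gt0 ek_gt0.
have [->|i_neq0] := eqVneq i ord0.
  by exists 0; split; [apply: nat_supported_in0 | rewrite mulmx0 subrr].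
have [l [fl_gt0 el_lt0]] :=
  conservation_negative_term f_ge0 (Mf0 i i_neq0) fk_gt0 ek_gt0.
have [neg_l tgt_l] := edge_vector_lt0 el_lt0.
have src_lt : (src (edge l) < m)%N.
  apply: leq_trans (negative_edge_src_lt_tgt neg_l) _.
  by rewrite tgt_l -ltnS.
have [g [fg Mg]] := IHm _ src_lt l fl_gt0 (edge_vector_src_gt0 R (edge l)).
exists (g + delta_mx l 0); split.
  exact: nat_supported_inD fg (nat_supported_in_delta fl_gt0).
rewrite mulmxDr Mg incidence_matrix_delta /edge_vector (negPf neg_l) tgt_l.
by rewrite addrA subrK.
Qed.

(** The coordinate sum of [M f] is twice the weight that [f] puts on the
    positive edges, negative edges contributing nothing. *)
Lemma positive_edge_in_support (R : realType) n (G : signed_graph n)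
    (f : 'cV[R]_(num_edges G)) :
  (forall l, 0 <= f l 0) -> \sum_i (incidence_matrix R G *m f) i 0 != 0 ->
  exists k, 0 < f k 0 /\ positive (edge k).
Proof.
move=> f_ge0 sum_neq0.
have [/existsP[k /andP[fk pk]]|/existsPn nopos] :=
  boolP [exists k, (0 < f k 0) && positive (edge k)].
  by exists k.
case/eqP: sum_neq0.
under eq_bigr => i _ do rewrite mxE.
rewrite exchange_big big1 //= => k _; rewrite -mulr_suml.
have := f_ge0 k; rewrite le_eqVlt => /predU1P[<-|fk_gt0]; first by rewrite mulr0.
have neg_k : ~~ positive (edge k) by have := nopos k; rewrite fk_gt0.
under eq_bigr => i _ do rewrite mxE.
by rewrite sum_negative_edge_vector // mul0r.
Qed.

(** The two paths may share edges, and both end at the same vertex when the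
    positive edge is a loop; adding them counts shared edges twice, which
    is why the flow is natural-valued rather than 0/1-valued. *)
Lemma integer_flow_in_support (R : realType) n (G : signed_graph n)
    (a : 'cV[R]_n.+1) (f : 'cV[R]_(num_edges G)) :
  a = delta_mx ord0 0 + delta_mx ord0 0 -> flow_polytope G a f ->
  exists g, nat_supported_in f g /\ incidence_matrix R G *m g = a.
Proof.
move=> aE [f_ge0 Mf].
have Mf0 i : i != ord0 -> (incidence_matrix R G *m f) i 0 = 0.
  by move=> /negPf i0; rewrite Mf aE !mxE i0 addr0.
have sum_neq0 : \sum_i (incidence_matrix R G *m f) i 0 != 0.
  rewrite (bigD1 ord0) //= (big1 _ _ _ Mf0) Mf aE !mxE eqxx addr0.
  by rewrite -natrD pnatr_eq0.
have [k [fk_gt0 pos_k]] := positive_edge_in_support f_ge0 sum_neq0.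
have [g [fg Mg]] := negative_path_in_support f_ge0 Mf0 fk_gt0
  (edge_vector_src_gt0 R (edge k)).
have [h [fh Mh]] := negative_path_in_support f_ge0 Mf0 fk_gt0
  (edge_vector_tgt_gt0 R pos_k).
exists (g + h + delta_mx k 0); split.
  apply: nat_supported_inD (nat_supported_in_delta fk_gt0).
  exact: nat_supported_inD fg fh.
rewrite !mulmxDr Mg Mh incidence_matrix_delta /edge_vector pos_k aE.
by rewrite addrACA !subrK.
Qed.

Lemma small_multiple_le (R : realType) m (f g : 'cV[R]_m) :
  (forall k, 0 <= f k 0) -> (forall k, 0 <= g k 0) ->
  (forall k, f k 0 = 0 -> g k 0 = 0) ->
  exists t : R, 0 < t < 1 /\ forall k, t * g k 0 <= f k 0.
Proof.
move=> f_ge0 g_ge0 fg0.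
(* The default 1/2 keeps [t] below 1, whatever the ratios are. *)
pose t : R := \big[Num.min/2^-1]_(k | 0 < g k 0) (f k 0 / g k 0).
have t_gt0 : 0 < t.
  apply: lt_bigmin => [|k gk_gt0]; first by rewrite invr_gt0 ltr0n.
  rewrite divr_gt0 // lt_neqAle f_ge0 andbT eq_sym.
  by apply: contraL gk_gt0 => /eqP/fg0->; rewrite ltxx.
have t_lt1 : t < 1.
  apply: le_lt_trans (bigmin_le_id _ _ _ _) _.
  by rewrite invf_lt1 ?ltr1n.
exists t; rewrite t_gt0 t_lt1; split=> // k.
have := g_ge0 k; rewrite le_eqVlt => /predU1P[<-|gk_gt0]; first by rewrite mulr0.
by rewrite -ler_pdivlMr // bigmin_le_cond.
Qed.

(** A vertex is determined by its support: a flow [g] supported inside that of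
    the vertex [f] can be split off from [f] with a small positive weight. *)
Lemma vertex_unique_in_support (R : realType) n (G : signed_graph n)
    (a : 'cV[R]_n.+1) (f g : 'cV[R]_(num_edges G)) :
  vertices (flow_polytope G a) f -> flow_polytope G a g ->
  (forall k, f k 0 = 0 -> g k 0 = 0) -> g = f.
Proof.
move=> [[f_ge0 Mf] f_extreme] Pg fg0; have [g_ge0 Mg] := Pg.
have [t [t01 tg_le_f]] := small_multiple_le f_ge0 g_ge0 fg0.
have [_ t_lt1] := andP t01.
have t1_neq0 : 1 - t != 0 by rewrite subr_eq0 gt_eqF.
pose h := (1 - t)^-1 *: (f - t *: g).
have Ph : flow_polytope G a h.
  split=> [k|].
    by rewrite !mxE mulr_ge0 // ?invr_ge0 subr_ge0 ?tg_le_f // ltW.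
  rewrite -scalemxAr mulmxBr -scalemxAr Mf Mg -{1}[a]scale1r -scalerBl.
  by rewrite scalerA mulVf // scale1r.
have f_split : f = t *: g + (1 - t) *: h.
  by rewrite scalerA divff // scale1r addrC subrK.
by have [] := f_extreme g h t Pg Ph t01 f_split.
Qed.

Theorem theorem3p11 (R : realType) (n : nat) (G : signed_graph n) :
  let a : 'cV[R]_n.+1 := \col_(i < n.+1) (if i == ord0 then 2 else 0) in
  (forall v, vertices (flow_polytope G a) v -> integral_vector v) /\
  vertices (flow_polytope G a) `<=` integer_flows G a.
Proof.
move=> a.
have aE : a = delta_mx ord0 0 + delta_mx ord0 0.
  by apply/colP => i; rewrite !mxE andbT; case: eqP => _; rewrite ?addr0 // -natrD.
have vertex_integral v : vertices (flow_polytope G a) v -> integral_vector v.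
  move=> vert_v; have [g [vg Mg]] := integer_flow_in_support aE vert_v.1.
  have Pg : flow_polytope G a g.
    by split=> // k; apply: natr_ge0; apply: (vg k).1.
  rewrite -(vertex_unique_in_support vert_v Pg (fun k => (vg k).2)) => k.
  by apply: intr_nat; apply: (vg k).1.
split=> // v vert_v; split; first exact: vert_v.1.
exact: vertex_integral.
Qed.
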